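(* Let $\beta$ and $\delta$ be arbitrary real constants satisfying $\beta\geq \max(\delta,-\delta-1)$. Taking $\alpha=\beta-\delta$, there exists a unique solution of a similarity type for the following one-phase Stefan problem: find a free boundary $s=s(t)$ and a temperature $T=T(x,t)$ such that $$a^2 T_{xx}(x,t)=T_t(x,t),\qquad 0<x<s(t),$$ $$T(0,t)=t^{\alpha/2}T_0,\qquad t>0,$$ $$T(s(t),t)=0,\qquad t>0,$$ $$-kT_x(s(t),t)=L(s(t),\dot{s}(t))\,\dot{s}(t),\qquad t>0,$$ $$s(0)=0,$$ where the latent heat per unit volume is $L(s(t),\dot{s}(t))=\gamma\, s(t)^{\beta}\,\dot{s}(t)^{\delta}$. This solution is given by $$T(x,t)=t^{\alpha/2}\left[c_1 M\left(-\frac{\alpha}{2},\frac12,-\eta^2\right)+c_2\,\eta\, M\left(-\frac{\alpha}{2}+\frac12,\frac32,-\eta^2\right)\right],\qquad s(t)=2a\xi\sqrt{t},$$ where $\eta=\dfrac{x}{2a\sqrt{t}}$, the constants $c_1$ and $c_2$ are given by $$c_1=T_0,\qquad c_2=\frac{-T_0\, M\left(-\frac{\alpha}{2},\frac12,-\xi^2\right)}{\xi\, M\left(-\frac{\alpha}{2}+\frac12,\frac32,-\xi^2\right)},$$ and the dimensionless coefficient $\xi$ is obtained as the unique positive solution of the equation $$\frac{kT_0}{\gamma\, a^{\beta+\delta+2}\,2^{\beta+1}}\, f(z)=z^{\beta+\delta+1},\qquad z>0,$$ in which $f$ is the real function defined by $$f(z)=\frac{1}{z\,M\left(\frac{\alpha}{2}+1,\frac32,z^2\right)},\qquad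 z>0.$$
   Context: The parameters $a^2$ (diffusion coefficient, with $a>0$) and $k>0$ (thermal conductivity) are known constants, $\gamma$ is a given constant, and the temperature $t^{\alpha/2}T_0$ imposed at the fixed face $x=0$ is positive, i.e. $T_0>0$. The dot denotes the derivative with respect to $t$. $M(a,b,z)$ denotes the Kummer function $$M(a,b,z)=\sum_{j=0}^{\infty}\frac{(a)_j}{(b)_j\, j!}z^j,$$ where $b$ is not a non-positive integer and $(a)_j$ is the Pochhammer symbol, $(a)_0=1$, $(a)_j=a(a+1)\cdots(a+j-1)$ for $j\ge 1$. (The letter $a$ as first argument of $M$ in this definition is a dummy variable, unrelated to the diffusion constant $a$.) A solution $(T,s)$ of a similarity type is one of the form $$T(x,t)=t^{\alpha/2}\varphi(\eta),\quad \eta=\frac{x}{2a\sqrt t},\qquad s(t)=2a\xi\sqrt{t},$$ for some function $\varphi$ of one variable and some positive constant $\xi$.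
   Formalization: The constant γ is assumed positive: for γ<0 the equation for ξ has a negative left side and a positive right side, so no solution exists, and for γ=0 the quotient in that equation is undefined. *)

(* Defs.v *)
From Stdlib Require Export Reals Factorial.
From Coquelicot Require Export Coquelicot.

Open Scope R_scope.

Fixpoint pochhammer (a : R) (j : nat) : R :=
  match j with
  | O => 1
  | S i => pochhammer a i * (a + INR i)
  end.

(* The series has infinite radius of convergence whenever b is not a
   non-positive integer; it is only used below with b = 1/2 and b = 3/2. *)
Definition kummerM (a b z : R) : R :=
  PSeries (fun j => pochhammer a j / (pochhammer b j * INR (fact j))) z.

(* One-sided: the temperature lives on x <= s(t), so the flux at the free
   boundary is the derivative from inside the phase. *)
Definition is_left_derive (f : R -> R) (x l : R) : Prop :=
  filterlim (fun y => (f y - f x) / (y - x)) (at_left x) (locally l).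

Definition phase (s : R -> R) (x t : R) : Prop := 0 < t /\ 0 <= x <= s t.

(* Classical solutions.  Values of T outside [phase s] and of s at negative
   times are irrelevant.  The heat equation is required at interior points,
   the boundary values are attached by continuity of T on [phase s]; no
   continuity at the initial corner (0,0) is asked for (T is discontinuous
   there when alpha = 0).  [L] is the latent heat as a function of s(t) and of
   the speed s'(t), both of which are positive: real powers of them are taken
   with [Rpower], which is meaningful for positive bases only. *)
Record stefan_solution (a k T0 alpha : R) (L : R -> R -> R)
    (T : R -> R -> R) (s : R -> R) : Prop := {
  stefan_front_pos : forall t, 0 < t -> 0 < s t;
  stefan_front_derive : forall t, 0 < t -> ex_derive s t;
  stefan_front_speed_pos : forall t, 0 < t -> 0 < Derive s t;
  stefan_continuous :
    continuous_on (fun p : R * R => phase s (fst p) (snd p))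
                  (fun p : R * R => T (fst p) (snd p));
  stefan_heat_regular : forall x t, 0 < t -> 0 < x < s t ->
    ex_derive (fun y => T y t) x /\
    ex_derive_n (fun y => T y t) 2 x /\
    ex_derive (fun u => T x u) t;
  stefan_heat : forall x t, 0 < t -> 0 < x < s t ->
    a ^ 2 * Derive_n (fun y => T y t) 2 x = Derive (fun u => T x u) t;
  stefan_fixed_face : forall t, 0 < t -> T 0 t = Rpower t (alpha / 2) * T0;
  stefan_front_temperature : forall t, 0 < t -> T (s t) t = 0;
  stefan_condition : forall t, 0 < t ->
    exists Tx, is_left_derive (fun y => T y t) (s t) Tx /\
      - k * Tx = L (s t) (Derive s t) * Derive s t;
  stefan_initial : s 0 = 0
}.

Definition similarity_type (a alpha : R) (T : R -> R -> R) (s : R -> R) : Prop :=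
  exists (phi : R -> R) (xi : R),
    0 < xi /\
    (forall t, 0 < t -> s t = 2 * a * xi * sqrt t) /\
    (forall x t, phase s x t ->
       T x t = Rpower t (alpha / 2) * phi (x / (2 * a * sqrt t))).

Definition latent_heat (gamma beta delta : R) (s sdot : R) : R :=
  gamma * Rpower s beta * Rpower sdot delta.

Definition f_xi (alpha z : R) : R :=
  1 / (z * kummerM (alpha / 2 + 1) (3 / 2) (z ^ 2)).

Definition xi_equation (a k gamma T0 beta delta alpha z : R) : Prop :=
  k * T0 / (gamma * Rpower a (beta + delta + 2) * Rpower 2 (beta + 1))
    * f_xi alpha z
  = Rpower z (beta + delta + 1).

Definition coef1 (T0 : R) : R := T0.

Definition coef2 (T0 alpha xi : R) : R :=
  - T0 * kummerM (- (alpha / 2)) (1 / 2) (- xi ^ 2)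
  / (xi * kummerM (- (alpha / 2) + 1 / 2) (3 / 2) (- xi ^ 2)).

Definition temperature (a T0 alpha xi : R) (x t : R) : R :=
  let eta := x / (2 * a * sqrt t) in
  Rpower t (alpha / 2) *
    (coef1 T0 * kummerM (- (alpha / 2)) (1 / 2) (- eta ^ 2)
     + coef2 T0 alpha xi * eta
       * kummerM (- (alpha / 2) + 1 / 2) (3 / 2) (- eta ^ 2)).

Definition front (a xi : R) (t : R) : R := 2 * a * xi * sqrt t.

(* Main.v *)
From Stdlib Require Import Lra.
Require Import Defs.

(** For T(x,t) = t^(alpha/2) phi(eta) with eta = x / (2 a sqrt t), the heat
    equation becomes the linear ODE
      phi'' + 2 eta phi' - 2 alpha phi = 0.
    Kummer's differential equation [kummer_ode] shows that
      A(eta) = M(-alpha/2, 1/2, -eta^2)           [even_sol]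
      B(eta) = eta M(-alpha/2 + 1/2, 3/2, -eta^2) [odd_sol]
    solve it, with A(0) = B'(0) = 1 and A'(0) = B(0) = 0.  For two solutions,
    the Wronskian times exp(eta^2) is constant [wronskian_const]; hence
    A B' - A' B = exp(-eta^2), and every solution on an interval is the
    combination of A and B whose coefficients are two such constants
    [solution_span].

    Two facts follow.  First,
    B(eta) = eta exp(-eta^2) M(alpha/2 + 1, 3/2, eta^2), because both sides have
    the same data at 0 [kummer_transformation]; all coefficients of this last
    series are positive when alpha >= 0, so B > 0 on (0, oo), and the boundary
    values phi(0) = T0, phi(xi) = 0 determine phi = c1 A + c2 B.  Second, for
    this phi the Wronskian gives
      phi'(xi) = - T0 exp(-xi^2) / B(xi) = - T0 f(xi),
    which turns the Stefan condition into the equation for xi: the powers of t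
    on its two sides agree exactly when alpha = beta - delta
    [similarity_stefan_condition].

    The equation for xi reads z^(beta+delta+2) M(alpha/2 + 1, 3/2, z^2) = K with
    K > 0.  Since beta + delta + 1 >= 0 and alpha >= 0, its left side increases
    strictly from 0 to infinity, so it has exactly one positive root
    [xi_equation_unique_root].

    Conversely, a similarity solution with front 2 a xi sqrt t has a profile
    that is only known to be differentiable inside (0, xi) and continuous on
    [0, xi].  The span argument on the open interval, followed by passage to
    the end points, identifies the profile [similarity_profile_unique]; its
    flux at the front then forces xi to satisfy the equation. *)

(** * The Kummer series and its differential equation *)

Lemma pochhammer_pos a j : 0 < a -> 0 < pochhammer a j.
Proof.
  intros Ha; induction j as [|j IH]; simpl; [lra|].
  apply Rmult_lt_0_compat; [exact IH|]. generalize (pos_INR j); lra.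
Qed.

Definition kummer_coef (a b : R) (j : nat) : R :=
  pochhammer a j / (pochhammer b j * INR (fact j)).

Lemma kummer_coef_step a b j : 0 < b ->
  kummer_coef a b (S j) * ((b + INR j) * INR (S j))
  = kummer_coef a b j * (a + INR j).
Proof.
  intros Hb. unfold kummer_coef.
  assert (H1 := pochhammer_pos b j Hb). assert (H2 := INR_fact_lt_0 j).
  assert (H3 := pos_INR j).
  rewrite fact_simpl, mult_INR, S_INR; simpl pochhammer.
  field; repeat split; lra.
Qed.

Lemma kummer_coef_nonneg a b j : 0 < a -> 0 < b -> 0 <= kummer_coef a b j.
Proof.
  intros Ha Hb. unfold kummer_coef. apply Rlt_le, Rdiv_lt_0_compat.
  - now apply pochhammer_pos.
  - apply Rmult_lt_0_compat; [now apply pochhammer_pos | apply INR_fact_lt_0].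
Qed.

Lemma kummer_coef_0 a b : kummer_coef a b 0 = 1.
Proof. unfold kummer_coef; simpl; field. Qed.

(** For b > 0 the ratio |a + j| / (b + j) never exceeds 1 + |a| / b, whence
    domination by an exponential series.  A ratio test on the coefficients
    themselves would fail when a is a non-positive integer, since they vanish
    from some rank on; this happens for M(-alpha/2, 1/2, .) with alpha an even
    integer. *)
Lemma kummer_coef_bound a b j : 0 < b ->
  Rabs (kummer_coef a b j) <= (1 + Rabs a / b) ^ j / INR (fact j).
Proof.
  intros Hb. induction j as [|j IH].
  - rewrite kummer_coef_0, Rabs_R1. simpl; lra.
  - assert (Hj := pos_INR j). assert (Hf := INR_fact_lt_0 j).
    assert (Ha := Rabs_pos a).
    assert (Hd : 0 < (b + INR j) * (INR j + 1)) by (apply Rmult_lt_0_compat; lra).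
    assert (E : kummer_coef a b (S j)
      = kummer_coef a b j * ((a + INR j) / ((b + INR j) * (INR j + 1)))).
    { apply Rmult_eq_reg_r with ((b + INR j) * INR (S j)).
      - rewrite kummer_coef_step by assumption. rewrite S_INR. field; lra.
      - rewrite S_INR; lra. }
    rewrite E, Rabs_mult, fact_simpl, mult_INR, S_INR; simpl pow.
    replace ((1 + Rabs a / b) * (1 + Rabs a / b) ^ j
             / ((INR j + 1) * INR (fact j)))
      with ((1 + Rabs a / b) ^ j / INR (fact j)
            * ((1 + Rabs a / b) / (INR j + 1))) by (field; lra).
    apply Rmult_le_compat; try apply Rabs_pos; [exact IH|].
    unfold Rdiv at 1.
    rewrite Rabs_mult, Rabs_inv, (Rabs_pos_eq ((b + _) * _)) by lra.
    apply Rle_div_l; [exact Hd|].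
    replace ((1 + Rabs a / b) / (INR j + 1) * ((b + INR j) * (INR j + 1)))
      with (b + INR j + Rabs a + Rabs a * INR j / b) by (field; lra).
    assert (0 <= Rabs a * INR j / b).
    { apply Rdiv_le_0_compat; [apply Rmult_le_pos; lra | lra]. }
    assert (T := Rabs_triang a (INR j)).
    rewrite (Rabs_pos_eq (INR j)) in T by lra. lra.
Qed.

Lemma pow_div_fact_le_exp x n : 0 <= x -> x ^ n / INR (fact n) <= exp x.
Proof.
  intros Hx.
  assert (H := is_exp_Reals x).
  apply is_pseries_R in H.
  assert (Hpos : forall j, 0 <= / INR (fact j) * x ^ j).
  { intros j. apply Rmult_le_pos; [left; apply Rinv_0_lt_compat, INR_fact_lt_0|].
    now apply pow_le. }
  replace (x ^ n / INR (fact n)) with (/ INR (fact n) * x ^ n)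
    by (unfold Rdiv; ring).
  apply Rle_trans with (sum_n (fun j => / INR (fact j) * x ^ j) n).
  - destruct n as [|n]; [rewrite sum_O; lra|].
    rewrite sum_Sn.
    assert (0 <= sum_n (fun j => / INR (fact j) * x ^ j) n).
    { rewrite sum_n_Reals. now apply cond_pos_sum. }
    unfold plus; simpl; simpl in *; lra.
  - apply (is_lim_seq_incr_compare
      (fun m => sum_n (fun j => / INR (fact j) * x ^ j) m)).
    + exact H.
    + intros m. rewrite sum_Sn. specialize (Hpos (S m)).
      unfold plus; simpl; simpl in *; lra.
Qed.

Lemma kummer_CV_radius a b : 0 < b -> CV_radius (kummer_coef a b) = p_infty.
Proof.
  intros Hb. destruct (CV_radius_bounded (kummer_coef a b)) as [Hub _].
  assert (Hle : forall r, 0 <= r -> Rbar_le r (CV_radius (kummer_coef a b))).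
  { intros r Hr. apply Hub.
    exists (exp ((1 + Rabs a / b) * r)). intros n.
    assert (0 <= Rabs a / b)
      by (apply Rdiv_le_0_compat; [apply Rabs_pos | exact Hb]).
    apply Rle_trans with (((1 + Rabs a / b) * r) ^ n / INR (fact n)).
    - rewrite Rabs_mult, (Rabs_pos_eq (r ^ n)) by now apply pow_le.
      rewrite Rpow_mult_distr.
      replace ((1 + Rabs a / b) ^ n * r ^ n / INR (fact n))
        with ((1 + Rabs a / b) ^ n / INR (fact n) * r ^ n)
        by (unfold Rdiv; ring).
      apply Rmult_le_compat_r; [now apply pow_le | now apply kummer_coef_bound].
    - apply pow_div_fact_le_exp. apply Rmult_le_pos; lra. }
  destruct (CV_radius (kummer_coef a b)) as [c| |]; [exfalso| reflexivity|].
  - assert (H0 := Hle (Rabs c + 1)). simpl in H0.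
    assert (Q := Rabs_pos c). assert (Q' := Rle_abs c). lra.
  - exfalso. exact (Hle 0 (Rle_refl 0)).
Qed.

Definition kummer_d1 (a b : R) : R -> R := PSeries (PS_derive (kummer_coef a b)).
Definition kummer_d2 (a b : R) : R -> R :=
  PSeries (PS_derive (PS_derive (kummer_coef a b))).

Lemma is_derive_kummer a b z : 0 < b ->
  is_derive (kummerM a b) z (kummer_d1 a b z).
Proof.
  intros Hb. apply (is_derive_PSeries (kummer_coef a b)).
  now rewrite kummer_CV_radius.
Qed.

Lemma is_derive_kummer_d1 a b z : 0 < b ->
  is_derive (kummer_d1 a b) z (kummer_d2 a b z).
Proof.
  intros Hb. apply is_derive_PSeries.
  now rewrite CV_radius_derive, kummer_CV_radius.
Qed.

(** Compared coefficient by coefficient, this is the recurrence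
    [kummer_coef_step] between consecutive coefficients. *)
Lemma kummer_ode a b z : 0 < b ->
  z * kummer_d2 a b z + (b - z) * kummer_d1 a b z - a * kummerM a b z = 0.
Proof.
  intros Hb. set (c := kummer_coef a b).
  assert (R0 : CV_radius c = p_infty) by now apply kummer_CV_radius.
  assert (X : forall d, CV_radius d = p_infty -> ex_pseries d z).
  { intros d Hd. apply CV_radius_inside. now rewrite Hd. }
  assert (R1 : CV_radius (PS_derive c) = p_infty)
    by now rewrite CV_radius_derive.
  assert (R2 : CV_radius (PS_derive (PS_derive c)) = p_infty)
    by now rewrite CV_radius_derive.
  assert (E : PSeries (PS_plus (PS_incr_1 (PS_derive (PS_derive c)))
                               (PS_scal b (PS_derive c))) z
            = PSeries (PS_plus (PS_incr_1 (PS_derive c)) (PS_scal a c)) z).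
  { apply PSeries_ext. intros j.
    unfold PS_plus, PS_scal, PS_incr_1, PS_derive.
    unfold plus, scal, zero; simpl; unfold mult; simpl.
    assert (Hs := kummer_coef_step a b j Hb). fold c in Hs.
    destruct j as [|j].
    - simpl in *. lra.
    - change (match j with 0%nat => 1 | S _ => INR j + 1 end)
        with (INR (S j)).
      rewrite !S_INR in *.
      match goal with |- ?x = ?y => change (@eq R x y) end. lra. }
  rewrite !PSeries_plus in E;
    auto using ex_pseries_incr_1, ex_pseries_scal, Rmult_comm.
  rewrite !PSeries_incr_1, !PSeries_scal in E.
  unfold kummer_d2, kummer_d1, kummerM. fold c.
  change (PSeries (fun j => pochhammer a j / (pochhammer b j * INR (fact j))) z)
    with (PSeries c z).
  lra.
Qed.

(** * Solutions of the similarity equation *)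
Lemma kummerM_0 a b : kummerM a b 0 = 1.
Proof. unfold kummerM. rewrite PSeries_0. apply kummer_coef_0. Qed.

Lemma kummerM_increasing a b y z : 0 < a -> 0 < b -> 0 <= y <= z ->
  kummerM a b y <= kummerM a b z.
Proof.
  intros Ha Hb Hyz. unfold kummerM, PSeries. apply Series_le.
  - intros j. assert (Hc := kummer_coef_nonneg a b j Ha Hb).
    fold (kummer_coef a b j). split.
    + apply Rmult_le_pos; [exact Hc | apply pow_le; lra].
    + apply Rmult_le_compat_l; [exact Hc | apply pow_incr; lra].
  - apply (ex_pseries_R (kummer_coef a b)), CV_radius_inside.
    now rewrite kummer_CV_radius.
Qed.

Lemma kummerM_ge_1 a b z : 0 < a -> 0 < b -> 0 <= z -> 1 <= kummerM a b z.
Proof.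
  intros Ha Hb Hz. rewrite <- (kummerM_0 a b).
  apply kummerM_increasing; auto; lra.
Qed.

(** The derivative [dy] is carried along explicitly, so that the predicate makes
    sense pointwise and the Wronskian below is a plain formula. *)
Definition solves_similarity_ode (alpha : R) (y dy : R -> R) (x : R) : Prop :=
  is_derive y x (dy x) /\ is_derive dy x (2 * alpha * y x - 2 * x * dy x).

Definition even_sol (alpha x : R) : R :=
  kummerM (- (alpha / 2)) (1 / 2) (- x ^ 2).
Definition even_sol' (alpha x : R) : R :=
  - (2 * x) * kummer_d1 (- (alpha / 2)) (1 / 2) (- x ^ 2).
Definition odd_sol (alpha x : R) : R :=
  x * kummerM (- (alpha / 2) + 1 / 2) (3 / 2) (- x ^ 2).
Definition odd_sol' (alpha x : R) : R :=
  kummerM (- (alpha / 2) + 1 / 2) (3 / 2) (- x ^ 2)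
  - 2 * x ^ 2 * kummer_d1 (- (alpha / 2) + 1 / 2) (3 / 2) (- x ^ 2).
(** The odd solution after Kummer's transformation M(p, b, -z) =
    exp(-z) M(b - p, b, z); in this form the series has positive coefficients
    for alpha >= 0. *)
Definition positive_sol (alpha x : R) : R :=
  x * exp (- x ^ 2) * kummerM (alpha / 2 + 1) (3 / 2) (x ^ 2).
Definition positive_sol' (alpha x : R) : R :=
  exp (- x ^ 2) * ((1 - 2 * x ^ 2) * kummerM (alpha / 2 + 1) (3 / 2) (x ^ 2)
                   + 2 * x ^ 2 * kummer_d1 (alpha / 2 + 1) (3 / 2) (x ^ 2)).

Lemma is_derive_kummer_comp a b (g : R -> R) x dg : 0 < b ->
  is_derive g x dg ->
  is_derive (fun u => kummerM a b (g u)) x (dg * kummer_d1 a b (g x)).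
Proof.
  intros Hb Hg. apply (is_derive_comp (kummerM a b) g);
    [now apply is_derive_kummer | exact Hg].
Qed.

Lemma is_derive_kummer_d1_comp a b (g : R -> R) x dg : 0 < b ->
  is_derive g x dg ->
  is_derive (fun u => kummer_d1 a b (g u)) x (dg * kummer_d2 a b (g x)).
Proof.
  intros Hb Hg. apply (is_derive_comp (kummer_d1 a b) g);
    [now apply is_derive_kummer_d1 | exact Hg].
Qed.

Lemma is_derive_opp_sqr x : is_derive (fun u => - u ^ 2) x (- (2 * x)).
Proof. auto_derive; [trivial | ring]. Qed.

Lemma is_derive_sqr x : is_derive (fun u => u ^ 2) x (2 * x).
Proof. auto_derive; [trivial | ring]. Qed.

Lemma is_derive_eq (f : R -> R) (x l l' : R) :
  is_derive f x l -> l = l' -> is_derive f x l'.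
Proof. now intros H <-. Qed.

Lemma is_derive_Rmult (f g : R -> R) x df dg :
  is_derive f x df -> is_derive g x dg ->
  is_derive (fun u => f u * g u) x (df * g x + f x * dg).
Proof. intros Hf Hg. apply (is_derive_mult f g); auto. exact Rmult_comm. Qed.

Lemma is_derive_Rplus (f g : R -> R) x df dg :
  is_derive f x df -> is_derive g x dg ->
  is_derive (fun u => f u + g u) x (df + dg).
Proof. exact (is_derive_plus f g x df dg). Qed.

Lemma is_derive_div_const (f : R -> R) (x df c : R) :
  is_derive f x df -> is_derive (fun u => f u / c) x (df / c).
Proof.
  intros Hf. apply (is_derive_ext (fun u => / c * f u)).
  - intros u. apply Rmult_comm.
  - eapply is_derive_eq; [apply is_derive_scal, Hf | apply Rmult_comm].
Qed.

(** Here and in the next two lemmas, the residual of the similarity equation is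
    an explicit multiple of Kummer's equation evaluated at -x^2 or x^2. *)
Lemma even_sol_ode alpha x :
  solves_similarity_ode alpha (even_sol alpha) (even_sol' alpha) x.
Proof.
  assert (Hb : 0 < 1 / 2) by lra. split; unfold even_sol, even_sol'.
  - apply (is_derive_kummer_comp _ _ (fun u => - u ^ 2) x (- (2 * x)) Hb),
    is_derive_opp_sqr.
  - eapply is_derive_eq.
    + apply is_derive_Rmult; [auto_derive; [trivial | reflexivity] |].
      apply (is_derive_kummer_d1_comp _ _ (fun u => - u ^ 2) x (- (2 * x)) Hb),
        is_derive_opp_sqr.
    + assert (E := kummer_ode (- (alpha / 2)) (1 / 2) (- x ^ 2) Hb).
      apply Rminus_diag_uniq.
      match type of E with ?e = 0 => transitivity (- 4 * e) end;
        [field | rewrite E; ring].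
Qed.

Lemma odd_sol_ode alpha x :
  solves_similarity_ode alpha (odd_sol alpha) (odd_sol' alpha) x.
Proof.
  assert (Hb : 0 < 3 / 2) by lra. split; unfold odd_sol, odd_sol'.
  - eapply is_derive_eq.
    + apply is_derive_Rmult; [apply (is_derive_id x) |].
      apply (is_derive_kummer_comp _ _ (fun u => - u ^ 2) x (- (2 * x)) Hb),
        is_derive_opp_sqr.
    + unfold one; simpl. ring.
  - eapply is_derive_eq.
    + apply (is_derive_minus (K := R_AbsRing) (V := R_NormedModule)).
      * apply (is_derive_kummer_comp _ _ (fun u => - u ^ 2) x (- (2 * x)) Hb),
          is_derive_opp_sqr.
      * apply is_derive_Rmult; [auto_derive; [trivial | reflexivity] |].
        apply (is_derive_kummer_d1_comp _ _ (fun u => - u ^ 2) x (- (2 * x)) Hb),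
          is_derive_opp_sqr.
    + assert (E := kummer_ode (- (alpha / 2) + 1 / 2) (3 / 2) (- x ^ 2) Hb).
      unfold minus, plus, opp; simpl plus; simpl opp.
      apply Rminus_diag_uniq.
      match type of E with ?e = 0 => transitivity (- 4 * x * e) end;
        [simpl; field | rewrite E; ring].
Qed.

Lemma positive_sol_ode alpha x :
  solves_similarity_ode alpha (positive_sol alpha) (positive_sol' alpha) x.
Proof.
  assert (Hb : 0 < 3 / 2) by lra. split; unfold positive_sol, positive_sol'.
  - eapply is_derive_eq.
    + apply is_derive_Rmult; [auto_derive; [trivial | reflexivity] |].
      apply (is_derive_kummer_comp _ _ (fun u => u ^ 2) x (2 * x) Hb),
        is_derive_sqr.
    + simpl; ring.
  - eapply is_derive_eq.
    + apply is_derive_Rmult; [auto_derive; [trivial | reflexivity] |].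
      apply is_derive_Rplus; apply is_derive_Rmult.
      * auto_derive; [trivial | reflexivity].
      * apply (is_derive_kummer_comp _ _ (fun u => u ^ 2) x (2 * x) Hb),
          is_derive_sqr.
      * auto_derive; [trivial | reflexivity].
      * apply (is_derive_kummer_d1_comp _ _ (fun u => u ^ 2) x (2 * x) Hb),
          is_derive_sqr.
    + assert (E := kummer_ode (alpha / 2 + 1) (3 / 2) (x ^ 2) Hb).
      apply Rminus_diag_uniq.
      match type of E with
        ?e = 0 => transitivity (4 * x * exp (- x ^ 2) * e) end;
        [simpl; field | rewrite E; ring].
Qed.

(** The weight exp(x^2) is the integrating factor of Abel's identity
    W' = - 2 x W for the similarity equation. *)
Definition wronskian (u du v dv : R -> R) (x : R) : R :=
  (u x * dv x - du x * v x) * exp (x ^ 2).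

Lemma wronskian_const alpha u du v dv x y : x < y ->
  (forall z, x <= z <= y -> solves_similarity_ode alpha u du z) ->
  (forall z, x <= z <= y -> solves_similarity_ode alpha v dv z) ->
  wronskian u du v dv x = wronskian u du v dv y.
Proof.
  intros Hxy Hu Hv. apply (eq_is_derive (wronskian u du v dv)); [|exact Hxy].
  intros z Hz. destruct (Hu z Hz) as [U1 U2], (Hv z Hz) as [V1 V2].
  unfold wronskian. eapply is_derive_eq.
  - apply is_derive_Rmult; [|auto_derive; [trivial | reflexivity]].
    apply (is_derive_minus (K := R_AbsRing) (V := R_NormedModule));
      apply is_derive_Rmult; eassumption.
  - unfold minus, plus, opp, zero; simpl. ring.
Qed.

(** [D] is any interval, possibly open: solutions coming from the Stefan problem
    satisfy the equation in the open phase only. *)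
Lemma wronskian_const_interval alpha u du v dv (D : R -> Prop) x y :
  (forall p q z, D p -> D q -> p <= z <= q -> D z) ->
  (forall z, D z -> solves_similarity_ode alpha u du z) ->
  (forall z, D z -> solves_similarity_ode alpha v dv z) ->
  D x -> D y -> wronskian u du v dv x = wronskian u du v dv y.
Proof.
  intros HD Hu Hv Hx Hy.
  destruct (Rtotal_order x y) as [L | [-> | L]]; [|reflexivity | symmetry];
    apply (wronskian_const alpha); auto; intros z Hz;
    ((now apply Hu, (HD _ _ _ Hx Hy)) || (now apply Hv, (HD _ _ _ Hx Hy))
     || (now apply Hu, (HD _ _ _ Hy Hx)) || (now apply Hv, (HD _ _ _ Hy Hx))).
Qed.

Lemma sol_values_0 alpha :
  (even_sol alpha 0 = 1 /\ even_sol' alpha 0 = 0) /\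
  (odd_sol alpha 0 = 0 /\ odd_sol' alpha 0 = 1) /\
  (positive_sol alpha 0 = 0 /\ positive_sol' alpha 0 = 1).
Proof.
  unfold even_sol, even_sol', odd_sol, odd_sol', positive_sol, positive_sol'.
  replace (- 0 ^ 2) with 0 by ring. replace (0 ^ 2) with 0 by ring.
  rewrite !kummerM_0, exp_0. repeat split; ring.
Qed.

Lemma even_odd_wronskian alpha x :
  even_sol alpha x * odd_sol' alpha x - even_sol' alpha x * odd_sol alpha x
  = exp (- x ^ 2).
Proof.
  assert (E : wronskian (even_sol alpha) (even_sol' alpha)
                (odd_sol alpha) (odd_sol' alpha) x = 1).
  { rewrite (wronskian_const_interval alpha _ _ _ _ (fun _ => True) x 0);
      auto using even_sol_ode, odd_sol_ode.
    destruct (sol_values_0 alpha) as [[A A'] [[B B'] _]].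
    unfold wronskian. rewrite A, A', B, B'.
    replace (0 ^ 2) with 0 by ring. rewrite exp_0. ring. }
  unfold wronskian in E.
  apply Rmult_eq_reg_r with (exp (x ^ 2)).
  - rewrite E, <- exp_plus. replace (- x ^ 2 + x ^ 2) with 0 by ring.
    now rewrite exp_0.
  - apply Rgt_not_eq, exp_pos.
Qed.

(** Cramer's rule: with W = A B' - A' B one has
    W y = (y B' - y' B) A + (A y' - A' y) B, and after division by W the two
    coefficients are weighted Wronskians of solutions, hence constant. *)
Lemma solution_span alpha y dy (D : R -> Prop) x0 :
  (forall p q z, D p -> D q -> p <= z <= q -> D z) -> D x0 ->
  (forall z, D z -> solves_similarity_ode alpha y dy z) ->
  forall x, D x ->
    y x = wronskian y dy (odd_sol alpha) (odd_sol' alpha) x0 * even_sol alpha x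
        + wronskian (even_sol alpha) (even_sol' alpha) y dy x0 * odd_sol alpha x.
Proof.
  intros HD H0 Hy x Hx.
  rewrite <- (wronskian_const_interval alpha y dy _ _ D x x0),
    <- (wronskian_const_interval alpha _ _ y dy D x x0);
    auto using even_sol_ode, odd_sol_ode.
  unfold wronskian.
  transitivity (y x * ((even_sol alpha x * odd_sol' alpha x
     - even_sol' alpha x * odd_sol alpha x) * exp (x ^ 2))); [|ring].
  rewrite even_odd_wronskian, <- exp_plus.
  replace (- x ^ 2 + x ^ 2) with 0 by ring. rewrite exp_0. ring.
Qed.

(** Both sides solve the same linear second-order equation with the same value
    0 and slope 1 at the origin. *)
Lemma kummer_transformation alpha x : odd_sol alpha x = positive_sol alpha x.
Proof.
  rewrite (solution_span alpha (positive_sol alpha) (positive_sol' alpha)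
             (fun _ => True) 0); auto using positive_sol_ode.
  destruct (sol_values_0 alpha) as [[A A'] [[B B'] [C C']]].
  unfold wronskian. rewrite A, A', B, B', C, C'.
  replace (0 ^ 2) with 0 by ring. rewrite exp_0. ring.
Qed.

(** Positivity of the odd solution makes [coef2] well defined; the formula for
    [f_xi] is the shape in which the flux at the front will produce it. *)
Lemma f_xi_odd_sol alpha x : 0 <= alpha -> 0 < x ->
  0 < odd_sol alpha x /\ f_xi alpha x = exp (- x ^ 2) / odd_sol alpha x.
Proof.
  intros Ha Hx. rewrite kummer_transformation. unfold positive_sol, f_xi.
  assert (HM := kummerM_ge_1 (alpha / 2 + 1) (3 / 2) (x ^ 2)
    ltac:(lra) ltac:(lra) (pow2_ge_0 x)).
  assert (He := exp_pos (- x ^ 2)). split.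
  - repeat apply Rmult_lt_0_compat; lra.
  - field; repeat split; lra.
Qed.

(** * The equation for the front coefficient *)

(** Clearing the denominator of [f_xi] leaves a strictly increasing function of
    the unknown. *)
Lemma xi_equation_iff a k gamma T0 beta delta alpha z :
  0 < a -> 0 < gamma -> 0 <= alpha -> 0 < z ->
  (xi_equation a k gamma T0 beta delta alpha z <->
   Rpower z (beta + delta + 2) * kummerM (alpha / 2 + 1) (3 / 2) (z ^ 2)
   = k * T0 / (gamma * Rpower a (beta + delta + 2) * Rpower 2 (beta + 1))).
Proof.
  intros Ha Hg Hal Hz. unfold xi_equation, f_xi.
  set (K := k * T0 / _).
  assert (HM := kummerM_ge_1 (alpha / 2 + 1) (3 / 2) (z ^ 2)
    ltac:(lra) ltac:(lra) (pow2_ge_0 z)).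
  set (M := kummerM _ _ _) in *.
  replace (beta + delta + 2) with (beta + delta + 1 + 1) by ring.
  rewrite (Rpower_plus (beta + delta + 1)), Rpower_1 by exact Hz.
  set (P := Rpower z _). split; intros E.
  - rewrite <- E. field. lra.
  - rewrite <- E. field. lra.
Qed.

Lemma power_kummer_increasing alpha p y z : 0 <= alpha -> 0 < p -> 0 < y < z ->
  Rpower y p * kummerM (alpha / 2 + 1) (3 / 2) (y ^ 2)
  < Rpower z p * kummerM (alpha / 2 + 1) (3 / 2) (z ^ 2).
Proof.
  intros Hal Hp Hyz.
  assert (H1 := kummerM_ge_1 (alpha / 2 + 1) (3 / 2) (y ^ 2)
    ltac:(lra) ltac:(lra) (pow2_ge_0 y)).
  apply Rlt_le_trans with
    (Rpower z p * kummerM (alpha / 2 + 1) (3 / 2) (y ^ 2)).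
  - apply Rmult_lt_compat_r; [lra|]. now apply Rlt_Rpower_l.
  - apply Rmult_le_compat_l; [left; apply exp_pos|].
    apply kummerM_increasing; try lra.
    split; [apply pow2_ge_0 | apply pow_incr; lra].
Qed.

(** In the variable y = ln z the logarithm of the left side is
    G(y) = p y + ln M(exp(y)^2), where the second term is nonnegative and
    nondecreasing; so explicit points lie below and above the level ln K, and
    the intermediate value theorem applies. *)
Lemma power_kummer_onto alpha p K : 0 <= alpha -> 0 < p -> 0 < K ->
  exists z, 0 < z /\
    Rpower z p * kummerM (alpha / 2 + 1) (3 / 2) (z ^ 2) = K.
Proof.
  intros Hal Hp HK.
  set (h := fun y => kummerM (alpha / 2 + 1) (3 / 2) (exp y ^ 2)).
  assert (Hh : forall y, 1 <= h y)
    by (intros y; apply kummerM_ge_1; [lra | lra | apply pow2_ge_0]).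
  assert (Hdh : forall y, ex_derive h y).
  { intros y. eexists. apply is_derive_kummer_comp; [lra|].
    auto_derive; [trivial | reflexivity]. }
  set (G := fun y => p * y + ln (h y)).
  assert (HG : continuity G).
  { intros y. apply continuity_pt_filterlim, (ex_derive_continuous G).
    unfold G. auto_derive. specialize (Hh y). split; [|split]; auto; lra. }
  assert (Hln : forall y, 0 <= ln (h y)).
  { intros y. rewrite <- ln_1. destruct (Hh y) as [L | <-]; [left|lra].
    apply ln_increasing; lra. }
  (* [y0 <= 0] bounds the second term of G by its value at 0; at [y1] it is
     dropped. *)
  set (y1 := ln K / p). set (y0 := Rmin 0 ((ln K - ln (h 0)) / p)).
  assert (E1 : ln K <= G y1).
  { unfold G, y1. specialize (Hln (ln K / p)).
    replace (p * (ln K / p)) with (ln K) by (field; lra). lra. }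
  assert (E0 : G y0 <= ln K).
  { unfold G. assert (A : y0 <= 0) by apply Rmin_l.
    assert (B : y0 <= (ln K - ln (h 0)) / p) by apply Rmin_r.
    assert (ln (h y0) <= ln (h 0)).
    { assert (Hm : h y0 <= h 0).
      { unfold h. apply kummerM_increasing; try lra.
        split; [apply pow2_ge_0|]. apply pow_incr. split; [left; apply exp_pos|].
        destruct A as [A | ->]; [left; now apply exp_increasing | lra]. }
      destruct Hm as [Hm | ->]; [left | lra].
      apply ln_increasing; [specialize (Hh y0); lra | exact Hm]. }
    apply Rle_div_r in B; [lra | exact Hp]. }
  destruct (IVT_gen G y0 y1 (ln K) HG) as [y [_ Ey]].
  { split.
    - eapply Rle_trans; [apply Rmin_l | exact E0].
    - eapply Rle_trans; [exact E1 | apply Rmax_r]. }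
  exists (exp y). split; [apply exp_pos|].
  unfold Rpower. rewrite ln_exp. fold (h y).
  rewrite <- (exp_ln (h y)) by (specialize (Hh y); lra).
  rewrite <- exp_plus. fold (G y). rewrite Ey. now apply exp_ln.
Qed.

Lemma xi_equation_unique_root a k gamma T0 beta delta alpha :
  0 < a -> 0 < k -> 0 < gamma -> 0 < T0 -> 0 <= alpha ->
  0 <= beta + delta + 1 ->
  exists xi,
    unique (fun z => 0 < z /\ xi_equation a k gamma T0 beta delta alpha z) xi.
Proof.
  intros Ha Hk Hg HT Hal Hp.
  destruct (power_kummer_onto alpha (beta + delta + 2)
    (k * T0 / (gamma * Rpower a (beta + delta + 2) * Rpower 2 (beta + 1))))
    as [xi [Hxi E]]; [exact Hal | lra | |].
  { apply Rdiv_lt_0_compat; repeat apply Rmult_lt_0_compat; auto; apply exp_pos. }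
  exists xi. split.
  - split; [exact Hxi|]. now apply xi_equation_iff.
  - intros z [Hz Ez]. apply xi_equation_iff in Ez; auto.
    rewrite <- E in Ez.
    destruct (Rtotal_order xi z) as [L | [Q | L]]; [|exact Q|];
      [assert (I := power_kummer_increasing alpha (beta + delta + 2) xi z)
      |assert (I := power_kummer_increasing alpha (beta + delta + 2) z xi)];
      specialize (I Hal ltac:(lra) ltac:(lra)); lra.
Qed.

(** * Functions of similarity form *)

Section Similarity.
Variables (a : R) (Ha : 0 < a).

Lemma scale_pos t : 0 < t -> 0 < 2 * a * sqrt t.
Proof.
  intros Ht. assert (H := sqrt_lt_R0 t Ht).
  repeat apply Rmult_lt_0_compat; lra.
Qed.

Lemma is_derive_similarity_x m phi x t d : 0 < t ->
  is_derive phi (x / (2 * a * sqrt t)) d ->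
  is_derive (fun y => Rpower t m * phi (y / (2 * a * sqrt t))) x
    (Rpower t m * d / (2 * a * sqrt t)).
Proof.
  intros Ht Hd. assert (Hs := scale_pos t Ht).
  eapply is_derive_eq.
  - apply is_derive_scal.
    apply (is_derive_comp phi (fun y => y / (2 * a * sqrt t))); [exact Hd|].
    auto_derive; [trivial | reflexivity].
  - unfold scal; simpl; unfold mult; simpl. field.
    assert (H := sqrt_lt_R0 t Ht). split; lra.
Qed.

Lemma is_derive_similarity_t m phi x t d : 0 < t ->
  is_derive phi (x / (2 * a * sqrt t)) d ->
  is_derive (fun u => Rpower u m * phi (x / (2 * a * sqrt u))) t
    (Rpower t m / t * (m * phi (x / (2 * a * sqrt t))
                       - x / (2 * a * sqrt t) / 2 * d)).
Proof.
  intros Ht Hd. assert (Hs := scale_pos t Ht).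
  assert (H := sqrt_lt_R0 t Ht).
  eapply is_derive_eq.
  - apply is_derive_Rmult.
    + apply is_derive_Reals, derivable_pt_lim_power, Ht.
    + apply (is_derive_comp phi (fun u => x / (2 * a * sqrt u))); [exact Hd|].
      auto_derive; [|reflexivity]. repeat split; [exact Ht | lra].
  - unfold scal; simpl; unfold mult; simpl.
    unfold Rminus at 1. rewrite Rpower_plus, Rpower_Ropp, Rpower_1 by exact Ht.
    assert (E : t = sqrt t * sqrt t) by (symmetry; apply sqrt_sqrt; lra).
    set (q := sqrt t) in *. rewrite E. field. lra.
Qed.

Lemma continuous_similarity m phi x t : 0 < t ->
  (forall z, continuous phi z) ->
  continuous (fun p : R * R =>
    Rpower (snd p) m * phi (fst p / (2 * a * sqrt (snd p)))) (x, t).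
Proof.
  intros Ht Hphi. assert (Hs := scale_pos t Ht).
  apply (continuous_mult (K := R_AbsRing)
           (fun p : R * R => Rpower (snd p) m)).
  - apply (continuous_comp snd (fun u => Rpower u m)); [apply continuous_snd|].
    apply (ex_derive_continuous (fun u => Rpower u m)). eexists.
    apply is_derive_Reals, derivable_pt_lim_power, Ht.
  - apply (continuous_comp (fun p : R * R => fst p / (2 * a * sqrt (snd p))) phi);
      [|apply Hphi].
    apply (continuous_mult (K := R_AbsRing) (fun p : R * R => fst p));
      [apply continuous_fst|].
    apply (continuous_comp snd (fun u => / (2 * a * sqrt u)));
      [apply continuous_snd|].
    apply (ex_derive_continuous (fun u => / (2 * a * sqrt u))).
    auto_derive. simpl. split; [exact Ht | split; [lra | trivial]].
Qed.
End Similarity.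

Lemma is_left_derive_of_is_derive (f : R -> R) (x l : R) :
  is_derive f x l -> is_left_derive f x l.
Proof.
  intros H. apply is_derive_Reals in H. unfold is_left_derive.
  apply filterlim_locally. intros eps.
  destruct (H eps (cond_pos eps)) as [del Hdel].
  exists del. intros y Hy Hlt.
  specialize (Hdel (y - x) ltac:(lra) Hy).
  rewrite (Rplus_minus x y) in Hdel. exact Hdel.
Qed.

(** * The explicit solution *)
Definition profile (alpha c1 c2 x : R) : R :=
  c1 * even_sol alpha x + c2 * odd_sol alpha x.
Definition profile' (alpha c1 c2 x : R) : R :=
  c1 * even_sol' alpha x + c2 * odd_sol' alpha x.

Lemma profile_ode alpha c1 c2 x :
  solves_similarity_ode alpha (profile alpha c1 c2) (profile' alpha c1 c2) x.
Proof.
  destruct (even_sol_ode alpha x) as [A1 A2], (odd_sol_ode alpha x) as [B1 B2].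
  unfold profile, profile'. split.
  - now apply is_derive_Rplus; apply is_derive_scal.
  - eapply is_derive_eq.
    + apply is_derive_Rplus; apply is_derive_scal; eassumption.
    + simpl; ring.
Qed.

Lemma profile_continuous alpha c1 c2 x : continuous (profile alpha c1 c2) x.
Proof.
  apply (ex_derive_continuous (profile alpha c1 c2)).
  exact (ex_intro _ _ (proj1 (profile_ode alpha c1 c2 x))).
Qed.

Lemma temperature_profile a T0 alpha xi x t :
  temperature a T0 alpha xi x t
  = Rpower t (alpha / 2)
    * profile alpha T0 (coef2 T0 alpha xi) (x / (2 * a * sqrt t)).
Proof. unfold temperature, profile, even_sol, odd_sol, coef1. ring. Qed.

Lemma coef2_sol T0 alpha xi :
  coef2 T0 alpha xi = - T0 * even_sol alpha xi / odd_sol alpha xi.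
Proof. reflexivity. Qed.

(** The value is zero by the choice of [coef2]; the slope is
    - T0 (A B' - A' B) / B at xi, where the Wronskian is exp(-xi^2). *)
Lemma profile_front alpha T0 xi : 0 <= alpha -> 0 < xi ->
  profile alpha T0 (coef2 T0 alpha xi) xi = 0 /\
  profile' alpha T0 (coef2 T0 alpha xi) xi = - T0 * f_xi alpha xi.
Proof.
  intros Hal Hxi. destruct (f_xi_odd_sol alpha xi Hal Hxi) as [HB ->].
  rewrite coef2_sol, <- (even_odd_wronskian alpha). unfold profile, profile'.
  split; field; lra.
Qed.

(** The left side is the flux of the explicit temperature at the front, and
    a xi / sqrt t is the speed of the front.  Both sides carry the same power of
    t, namely sqrt t to the beta - delta - 1, so the condition does not depend on
    t and reduces to the equation for xi. *)
Lemma similarity_stefan_condition a k gamma T0 beta delta alpha xi t :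
  0 < a -> 0 < gamma -> alpha = beta - delta -> 0 < xi -> 0 < t ->
  (- k * (Rpower t (alpha / 2) * (- T0 * f_xi alpha xi) / (2 * a * sqrt t))
   = latent_heat gamma beta delta (2 * a * xi * sqrt t) (a * xi / sqrt t)
     * (a * xi / sqrt t)
   <-> xi_equation a k gamma T0 beta delta alpha xi).
Proof.
  intros Ha Hg Hal Hxi Ht. assert (Hs := sqrt_lt_R0 t Ht).
  unfold latent_heat, xi_equation. set (F := f_xi alpha xi).
  assert (Hax : 0 < a * xi) by now apply Rmult_lt_0_compat.
  set (q := sqrt t) in *.
  assert (Et : Rpower t (alpha / 2) = Rpower q beta * / Rpower q delta).
  { rewrite <- Rpower_Ropp, <- Rpower_plus. unfold q.
    rewrite <- Rpower_sqrt, Rpower_mult by exact Ht.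
    f_equal. rewrite Hal. field. }
  assert (E1 : Rpower (2 * a * xi * q) beta
               = Rpower 2 beta * Rpower (a * xi) beta * Rpower q beta).
  { rewrite !Rpower_mult_distr by (repeat apply Rmult_lt_0_compat; lra).
    f_equal; ring. }
  assert (E2 : Rpower (a * xi / q) delta
               = Rpower (a * xi) delta * / Rpower q delta).
  { rewrite <- Rpower_Ropp.
    replace (- delta) with (Ropp 1 * delta) by ring.
    rewrite <- Rpower_mult, Rpower_mult_distr by (try apply exp_pos; exact Hax).
    f_equal. rewrite Rpower_Ropp, Rpower_1 by exact Hs. reflexivity. }
  assert (E3 : Rpower xi (beta + delta + 1)
               = Rpower xi beta * Rpower xi delta * xi)
    by now rewrite !Rpower_plus, Rpower_1.
  assert (E4 : Rpower a (beta + delta + 2)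
               = Rpower a beta * Rpower a delta * a * a).
  { replace (beta + delta + 2) with (beta + delta + 1 + 1) by ring.
    now rewrite !Rpower_plus, Rpower_1. }
  assert (E5 : Rpower 2 (beta + 1) = Rpower 2 beta * 2)
    by (rewrite Rpower_plus, Rpower_1; lra).
  (* All real powers are now products of powers with exponent beta or delta. *)
  rewrite Et, E1, E2, E3, E4, E5, <- !Rpower_mult_distr by assumption.
  assert (P : forall u v, 0 < Rpower u v) by (intros; apply exp_pos).
  assert (P1 := P q beta). assert (P2 := P q delta).
  assert (P3 := P a beta). assert (P4 := P a delta).
  assert (P5 := P 2 beta).
  set (Qb := Rpower q beta) in *. set (Qd := Rpower q delta) in *.
  set (Ab := Rpower a beta) in *. set (Ad := Rpower a delta) in *.
  set (Tb := Rpower 2 beta) in *.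
  set (Xb := Rpower xi beta). set (Xd := Rpower xi delta).
  (* [W] is the common factor of the two sides of the Stefan condition. *)
  set (W := Qb / Qd / q * (gamma * Tb * Ab * Ad * a)).
  assert (HW : W <> 0).
  { unfold W, Rdiv. apply Rgt_not_eq.
    repeat (apply Rmult_lt_0_compat || apply Rinv_0_lt_compat); auto. }
  match goal with |- ?l = ?r <-> ?l' = ?r' =>
    assert (L : l = W * l') by (unfold W; field; repeat split; lra);
    assert (R0 : r = W * r') by (unfold W; field; repeat split; lra) end.
  rewrite L, R0. split; [|now intros ->].
  intros E. exact (Rmult_eq_reg_l _ _ _ E HW).
Qed.

Lemma is_derive_temperature_x a T0 alpha xi x t : 0 < a -> 0 < t ->
  is_derive (fun y => temperature a T0 alpha xi y t) x
    (Rpower t (alpha / 2)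
     * profile' alpha T0 (coef2 T0 alpha xi) (x / (2 * a * sqrt t))
     / (2 * a * sqrt t)).
Proof.
  intros Ha Ht.
  apply (is_derive_ext (fun y => Rpower t (alpha / 2)
    * profile alpha T0 (coef2 T0 alpha xi) (y / (2 * a * sqrt t)))).
  - intros y. symmetry. apply temperature_profile.
  - apply is_derive_similarity_x; [exact Ha | exact Ht | apply profile_ode].
Qed.

Lemma is_derive_temperature_xx a T0 alpha xi x t : 0 < a -> 0 < t ->
  is_derive (Derive (fun y => temperature a T0 alpha xi y t)) x
    (Rpower t (alpha / 2) / (4 * a ^ 2 * t)
     * (2 * alpha * profile alpha T0 (coef2 T0 alpha xi) (x / (2 * a * sqrt t))
        - 2 * (x / (2 * a * sqrt t))
          * profile' alpha T0 (coef2 T0 alpha xi) (x / (2 * a * sqrt t)))).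
Proof.
  intros Ha Ht. assert (Hs := sqrt_lt_R0 t Ht).
  apply (is_derive_ext (fun y => Rpower t (alpha / 2)
    * (profile' alpha T0 (coef2 T0 alpha xi) (y / (2 * a * sqrt t))
       / (2 * a * sqrt t)))).
  - intros y. symmetry. apply is_derive_unique.
    eapply is_derive_eq; [now apply is_derive_temperature_x|].
    unfold Rdiv; ring.
  - eapply is_derive_eq.
    + apply (is_derive_similarity_x a Ha (alpha / 2)
        (fun z => profile' alpha T0 (coef2 T0 alpha xi) z / (2 * a * sqrt t)));
        [exact Ht|].
      apply is_derive_div_const, profile_ode.
    + assert (E : t = sqrt t * sqrt t) by (symmetry; apply sqrt_sqrt; lra).
      set (p := Rpower t _). set (q := sqrt t) in *.
      rewrite E. field. lra.
Qed.

Lemma is_derive_temperature_t a T0 alpha xi x t : 0 < a -> 0 < t ->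
  is_derive (fun u => temperature a T0 alpha xi x u) t
    (Rpower t (alpha / 2) / t
     * (alpha / 2 * profile alpha T0 (coef2 T0 alpha xi) (x / (2 * a * sqrt t))
        - x / (2 * a * sqrt t) / 2
          * profile' alpha T0 (coef2 T0 alpha xi) (x / (2 * a * sqrt t)))).
Proof.
  intros Ha Ht.
  apply (is_derive_ext (fun u => Rpower u (alpha / 2)
    * profile alpha T0 (coef2 T0 alpha xi) (x / (2 * a * sqrt u)))).
  - intros u. symmetry. apply temperature_profile.
  - apply is_derive_similarity_t; [exact Ha | exact Ht | apply profile_ode].
Qed.

Lemma is_derive_front a xi t : 0 < t ->
  is_derive (front a xi) t (a * xi / sqrt t).
Proof.
  intros Ht. assert (Hs := sqrt_lt_R0 t Ht). unfold front.
  auto_derive; [exact Ht|]. field. lra.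
Qed.

Lemma front_similarity_variable a xi t : 0 < a -> 0 < t ->
  front a xi t / (2 * a * sqrt t) = xi.
Proof.
  intros Ha Ht. assert (Hs := sqrt_lt_R0 t Ht). unfold front. field. lra.
Qed.

Lemma temperature_flux a T0 alpha xi t :
  0 < a -> 0 <= alpha -> 0 < xi -> 0 < t ->
  is_left_derive (fun y => temperature a T0 alpha xi y t) (front a xi t)
    (Rpower t (alpha / 2) * (- T0 * f_xi alpha xi) / (2 * a * sqrt t)).
Proof.
  intros Ha Hal Hxi Ht. apply is_left_derive_of_is_derive.
  rewrite <- (proj2 (profile_front alpha T0 xi Hal Hxi)).
  assert (H := is_derive_temperature_x a T0 alpha xi (front a xi t) t Ha Ht).
  now rewrite front_similarity_variable in H.
Qed.

Lemma profile_0 alpha c1 c2 : profile alpha c1 c2 0 = c1.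
Proof.
  destruct (sol_values_0 alpha) as [[A _] [[B _] _]].
  unfold profile. rewrite A, B. ring.
Qed.

Lemma temperature_solves_stefan a k gamma T0 beta delta alpha xi :
  0 < a -> 0 < gamma -> 0 <= alpha -> alpha = beta - delta ->
  0 < xi -> xi_equation a k gamma T0 beta delta alpha xi ->
  stefan_solution a k T0 alpha (latent_heat gamma beta delta)
    (temperature a T0 alpha xi) (front a xi).
Proof.
  intros Ha Hg Hal Hab Hxi E.
  assert (Hax : 0 < a * xi) by now apply Rmult_lt_0_compat.
  constructor.
  - intros t Ht. assert (Hs := sqrt_lt_R0 t Ht). unfold front.
    repeat apply Rmult_lt_0_compat; lra.
  - intros t Ht. eexists. now apply is_derive_front.
  - intros t Ht. assert (Hs := sqrt_lt_R0 t Ht).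
    rewrite (is_derive_unique _ _ _ (is_derive_front a xi t Ht)).
    now apply Rdiv_lt_0_compat.
  - apply continuous_on_forall. intros [x t] [Ht _].
    apply (continuous_ext (fun p : R * R => Rpower (snd p) (alpha / 2)
      * profile alpha T0 (coef2 T0 alpha xi) (fst p / (2 * a * sqrt (snd p))))).
    + intros p. symmetry. apply temperature_profile.
    + apply continuous_similarity; [exact Ha | exact Ht |].
      intros z. apply profile_continuous.
  - intros x t Ht _. split; [|split].
    + exact (ex_intro _ _ (is_derive_temperature_x a T0 alpha xi x t Ha Ht)).
    + exact (ex_intro _ _ (is_derive_temperature_xx a T0 alpha xi x t Ha Ht)).
    + exact (ex_intro _ _ (is_derive_temperature_t a T0 alpha xi x t Ha Ht)).
  - intros x t Ht _. assert (Hs := sqrt_lt_R0 t Ht).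
    assert (Ext := is_derive_unique _ _ _
      (is_derive_temperature_t a T0 alpha xi x t Ha Ht)).
    assert (Exx := is_derive_unique _ _ _
      (is_derive_temperature_xx a T0 alpha xi x t Ha Ht)).
    refine (eq_trans (f_equal (Rmult (a ^ 2)) Exx) (eq_trans _ (eq_sym Ext))).
    field. repeat split; lra.
  - intros t Ht. rewrite temperature_profile.
    replace (0 / (2 * a * sqrt t)) with 0 by (unfold Rdiv; ring).
    now rewrite profile_0.
  - intros t Ht. rewrite temperature_profile, front_similarity_variable by auto.
    rewrite (proj1 (profile_front alpha T0 xi Hal Hxi)). ring.
  - intros t Ht. eexists. split; [now apply temperature_flux|].
    rewrite (is_derive_unique _ _ _ (is_derive_front a xi t Ht)).
    now apply similarity_stefan_condition.
  - unfold front. rewrite sqrt_0. ring.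
Qed.

(** * Uniqueness among similarity solutions *)
Lemma eq_on_closed_interval (f g : R -> R) l r : l < r ->
  continuous_on (fun x => l <= x <= r) f ->
  (forall x, continuous g x) ->
  (forall x, l < x < r -> f x = g x) ->
  forall x, l <= x <= r -> f x = g x.
Proof.
  intros Hlr Hf Hg Heq x Hx.
  (* Every point of [l, r] adheres to the open interval: step from x towards
     the farther end point. *)
  assert (FF : ProperFilter' (within (fun y => l < y < r) (locally x))).
  { split; [|apply within_filter, locally_filter].
    intros [eps H].
    set (d := Rmin (eps / 2) ((r - l) / 4)).
    assert (D1 : 0 < d).
    { apply Rmin_case; [destruct eps; simpl; lra | lra]. }
    assert (D2 : d <= eps / 2) by apply Rmin_l.
    assert (D3 : d <= (r - l) / 4) by apply Rmin_r.
    assert (He := cond_pos eps).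
    assert (B : forall y, Rabs (y - x) <= d -> l < y < r -> False).
    { intros y Hy. apply H. change (Rabs (y - x) < eps). lra. }
    destruct (Rle_dec x ((l + r) / 2)).
    - apply (B (x + d)); [rewrite Rabs_pos_eq; lra | lra].
    - apply (B (x - d)); [rewrite Rabs_left; lra | lra]. }
  apply (filterlim_locally_unique (F := within (fun y => l < y < r) (locally x))
           f (f x) (g x)).
  - apply (filterlim_filter_le_1 _
      (F := within (fun y => l <= y <= r) (locally x))); [|now apply Hf].
    intros P [eps H]. exists eps. intros y Hy Hlr'. apply H; [exact Hy | lra].
  - apply (filterlim_within_ext _ g).
    + intros y Hy. symmetry. now apply Heq.
    + apply (filterlim_filter_le_1 _ (F := locally x)); [|apply Hg].
      intros P [eps H]. exists eps. intros y Hy _. now apply H.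
Qed.

Lemma is_left_derive_eq (f g : R -> R) l x df dg : l < x ->
  (forall y, l <= y <= x -> f y = g y) ->
  is_left_derive f x df -> is_left_derive g x dg -> df = dg.
Proof.
  intros Hlx Heq Hf Hg.
  apply (filterlim_locally_unique (F := at_left x)
    (fun y => (f y - f x) / (y - x)) df dg Hf).
  apply (filterlim_ext_loc (fun y => (g y - g x) / (y - x))); [|exact Hg].
  assert (Hd : 0 < x - l) by lra.
  exists (mkposreal _ Hd). intros y Hy Hyx.
  change (Rabs (y - x) < x - l) in Hy. apply Rabs_def2 in Hy.
  rewrite !Heq by lra. reflexivity.
Qed.

Section SimilaritySolution.
Variables (a k T0 alpha : R) (L T : R -> R -> R) (s phi : R -> R) (xi : R).
Hypotheses (Ha : 0 < a) (Hxi : 0 < xi) (Hal : 0 <= alpha)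
  (HS : stefan_solution a k T0 alpha L T s)
  (Hs : forall t, 0 < t -> s t = 2 * a * xi * sqrt t)
  (HT : forall x t, phase s x t ->
     T x t = Rpower t (alpha / 2) * phi (x / (2 * a * sqrt t))).

(** At this time 2 a sqrt t0 = 1, so x itself is the similarity variable and the
    profile can be read off the temperature. *)
Let t0 := (/ (2 * a)) ^ 2.
Let amp := Rpower t0 (alpha / 2).
(** The profile [phi] is constrained on [0, xi] only, and nothing is assumed of
    its regularity; [psi] is the same function there, and inherits regularity
    from [T]. *)
Let psi x := T x t0 / amp.
Let dpsi x := Derive (fun y => T y t0) x / amp.

Lemma t0_pos : 0 < t0.
Proof. apply pow_lt, Rinv_0_lt_compat. lra. Qed.

Lemma sqrt_t0 : sqrt t0 = / (2 * a).
Proof.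
  unfold t0. apply sqrt_pow2. left. apply Rinv_0_lt_compat. lra.
Qed.

Lemma scale_t0 : 2 * a * sqrt t0 = 1.
Proof. rewrite sqrt_t0. field. lra. Qed.

Lemma front_t0 : s t0 = xi.
Proof. rewrite (Hs t0 t0_pos), sqrt_t0. field. lra. Qed.

Lemma amp_pos : 0 < amp.
Proof. apply exp_pos. Qed.

Lemma psi_phi x : 0 <= x <= xi -> psi x = phi x.
Proof.
  intros Hx. unfold psi. rewrite HT, scale_t0.
  - fold amp. replace (x / 1) with x by field. field. apply Rgt_not_eq, amp_pos.
  - split; [exact t0_pos | rewrite front_t0; exact Hx].
Qed.

(** Derivatives in x at time t0 are those of the profile.  The derivative in t is
    found by the chain rule, as [T] has similarity form at all times near t0 for
    a fixed interior point x. *)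
Lemma psi_ode x : 0 < x < xi -> solves_similarity_ode alpha psi dpsi x.
Proof.
  intros Hx. assert (Hc := amp_pos). assert (Ht := t0_pos).
  assert (Hx' : 0 < x < s t0) by now rewrite front_t0.
  destruct (stefan_heat_regular _ _ _ _ _ _ _ HS x t0 Ht Hx') as [D1 [D2 _]].
  assert (P1 : is_derive psi x (dpsi x))
    by now apply is_derive_div_const, Derive_correct.
  assert (P2 : is_derive dpsi x (Derive_n (fun y => T y t0) 2 x / amp))
    by now apply is_derive_div_const, Derive_correct.
  split; [exact P1|]. eapply is_derive_eq; [exact P2|].
  assert (Pphi : is_derive phi (x / (2 * a * sqrt t0)) (dpsi x)).
  { rewrite scale_t0, Rdiv_1_r.
    apply (is_derive_ext_loc psi); [|exact P1].
    apply (locally_interval _ x 0 xi); simpl; try lra.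
    intros y Hy1 Hy2. apply psi_phi; lra. }
  assert (Pt : is_derive (fun u => T x u) t0
    (amp / t0 * (alpha / 2 * psi x - x / 2 * dpsi x))).
  { apply (is_derive_ext_loc
      (fun u => Rpower u (alpha / 2) * phi (x / (2 * a * sqrt u)))).
    (* The point x lies in the phase at time u as soon as u > (x/(2 a xi))^2. *)
    - apply (locally_interval _ t0 ((x / (2 * a * xi)) ^ 2) p_infty);
        [|exact I|].
      + change ((x / (2 * a * xi)) ^ 2 < (/ (2 * a)) ^ 2).
        rewrite <- !Rsqr_pow2.
        apply Rsqr_incrst_1.
        * apply Rlt_div_l; [repeat apply Rmult_lt_0_compat; lra|].
          replace (/ (2 * a) * (2 * a * xi)) with xi by (field; lra). lra.
        * apply Rdiv_le_0_compat; [lra | repeat apply Rmult_lt_0_compat; lra].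
        * left. apply Rinv_0_lt_compat. lra.
      + intros u Hu _. change ((x / (2 * a * xi)) ^ 2 < u) in Hu.
        assert (H2 : 0 <= x / (2 * a * xi)).
        { apply Rdiv_le_0_compat; [lra | repeat apply Rmult_lt_0_compat; lra]. }
        assert (Hu0 : 0 < u).
        { eapply Rle_lt_trans; [|exact Hu]. now apply pow_le. }
        symmetry. apply HT. split; [exact Hu0|]. split; [lra|].
        rewrite (Hs u Hu0).
        assert (Q : x / (2 * a * xi) <= sqrt u).
        { rewrite <- (sqrt_pow2 (x / (2 * a * xi))) by exact H2.
          apply sqrt_le_1_alt. left. exact Hu. }
        apply Rle_div_l in Q; [lra | repeat apply Rmult_lt_0_compat; lra].
    - eapply is_derive_eq.
      + apply is_derive_similarity_t; [exact Ha | exact Ht | exact Pphi].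
      + rewrite scale_t0, Rdiv_1_r, psi_phi by lra. reflexivity. }
  assert (H := eq_trans (stefan_heat _ _ _ _ _ _ _ HS x t0 Ht Hx')
                 (is_derive_unique _ _ _ Pt)).
  set (D := Derive_n _ 2 x) in *.
  assert (Hat : t0 = / (4 * a ^ 2)) by (unfold t0; field; lra).
  apply Rmult_eq_reg_l with (a ^ 2 * amp).
  - transitivity (a ^ 2 * D); [field; lra|]. rewrite H, Hat. field. lra.
  - apply Rgt_not_eq, Rmult_lt_0_compat; [now apply pow_lt | exact Hc].
Qed.

Lemma psi_continuous : continuous_on (fun x => 0 <= x <= xi) psi.
Proof.
  intros x Hx. unfold psi, Rdiv.
  assert (Hph : phase s x t0) by (split; [exact t0_pos | now rewrite front_t0]).
  assert (HC := stefan_continuous _ _ _ _ _ _ _ HS (x, t0) Hph). simpl in HC.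
  apply (filterlim_comp _ _ _ (fun y => T y t0) (fun v => v * / amp) _
           (locally (T x t0))).
  - apply (filterlim_comp _ _ _ (fun y => (y, t0))
      (fun p : R * R => T (fst p) (snd p)) _
      (within (fun p : R * R => phase s (fst p) (snd p)) (locally (x, t0))));
      [|exact HC].
    intros P [eps H]. exists eps. intros y Hy Hy'. apply H.
    + split; [exact Hy | apply ball_center].
    + split; [exact t0_pos | simpl; now rewrite front_t0].
  - apply (continuous_mult (K := R_AbsRing) (fun v : R => v) (fun _ => / amp));
      [apply continuous_id | apply continuous_const].
Qed.

(** The coefficients of the combination on (0, xi) survive at the end points by
    continuity, where the boundary values T0 and 0 determine them. *)
Lemma similarity_profile_unique x : 0 <= x <= xi ->
  phi x = profile alpha T0 (coef2 T0 alpha xi) x.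
Proof.
  destruct (f_xi_odd_sol alpha xi Hal Hxi) as [HB _].
  set (c1 := wronskian psi dpsi (odd_sol alpha) (odd_sol' alpha) (xi / 2)).
  set (c2 := wronskian (even_sol alpha) (even_sol' alpha) psi dpsi (xi / 2)).
  assert (Hpsi : forall z, 0 <= z <= xi -> psi z = profile alpha c1 c2 z).
  { apply eq_on_closed_interval; [exact Hxi | exact psi_continuous | |].
    - intros z. apply profile_continuous.
    - unfold profile, c1, c2.
      apply (solution_span alpha psi dpsi (fun z => 0 < z < xi));
        [intros; lra | lra | exact psi_ode]. }
  assert (Hc := amp_pos).
  assert (E1 : c1 = T0).
  { rewrite <- (profile_0 alpha c1 c2), <- Hpsi by lra. unfold psi.
    rewrite (stefan_fixed_face _ _ _ _ _ _ _ HS t0 t0_pos). fold amp.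
    field. lra. }
  assert (E2 : c2 = coef2 T0 alpha xi).
  { assert (E := stefan_front_temperature _ _ _ _ _ _ _ HS t0 t0_pos).
    rewrite front_t0 in E. assert (Ep : psi xi = 0)
      by (unfold psi; rewrite E; unfold Rdiv; ring).
    rewrite Hpsi in Ep by lra. unfold profile in Ep.
    rewrite coef2_sol, <- E1.
    apply Rmult_eq_reg_r with (odd_sol alpha xi); [|lra].
    transitivity (- c1 * even_sol alpha xi); [lra | field; lra]. }
  intros Hx. rewrite <- psi_phi, Hpsi, E1, E2 by exact Hx. reflexivity.
Qed.

Lemma similarity_temperature_unique x t : phase s x t ->
  T x t = temperature a T0 alpha xi x t.
Proof.
  intros Hph. rewrite temperature_profile, (HT x t Hph).
  rewrite similarity_profile_unique; [reflexivity|].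
  destruct Hph as [Ht [Hx0 Hxs]]. rewrite (Hs t Ht) in Hxs.
  assert (Hd := scale_pos a Ha t Ht). split.
  - now apply Rdiv_le_0_compat.
  - apply Rle_div_l; [exact Hd | lra].
Qed.
End SimilaritySolution.

(** [T] coincides with the explicit temperature on the whole phase, so the two
    have the same one-sided flux at the front; one time, t = 1, is enough. *)
Lemma similarity_solution_xi_equation a k gamma T0 beta delta alpha T s phi xi :
  0 < a -> 0 < gamma -> 0 <= alpha -> alpha = beta - delta -> 0 < xi ->
  stefan_solution a k T0 alpha (latent_heat gamma beta delta) T s ->
  (forall t, 0 < t -> s t = 2 * a * xi * sqrt t) ->
  (forall x t, phase s x t ->
     T x t = Rpower t (alpha / 2) * phi (x / (2 * a * sqrt t))) ->
  xi_equation a k gamma T0 beta delta alpha xi.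
Proof.
  intros Ha Hg Hal Hab Hxi HS Hs HT.
  assert (H1 := Rlt_0_1).
  destruct (stefan_condition _ _ _ _ _ _ _ HS 1 H1) as [Tx [HTx E]].
  assert (Hpos := stefan_front_pos _ _ _ _ _ _ _ HS 1 H1).
  assert (ETx : Tx = Rpower 1 (alpha / 2) * (- T0 * f_xi alpha xi)
                     / (2 * a * sqrt 1)).
  { assert (HF := temperature_flux a T0 alpha xi 1 Ha Hal Hxi H1).
    unfold front in HF. rewrite <- (Hs 1 H1) in HF.
    apply (is_left_derive_eq _ _ 0 (s 1) _ _ Hpos) with (2 := HTx) (3 := HF).
    intros y Hy.
    apply (similarity_temperature_unique a k T0 alpha
      (latent_heat gamma beta delta) T s phi); auto.
    now split. }
  assert (ED : Derive s 1 = a * xi / sqrt 1).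
  { rewrite (Derive_ext_loc s (front a xi)).
    - apply is_derive_unique, is_derive_front, H1.
    - apply (locally_interval _ 1 0 p_infty); simpl; [lra | trivial |].
      intros u Hu _. now apply Hs. }
  rewrite ED, (Hs 1 H1), ETx in E.
  now apply similarity_stefan_condition in E.
Qed.

Theorem theorem3p1 :
  forall (a k gamma T0 beta delta alpha : R),
    0 < a -> 0 < k -> 0 < gamma -> 0 < T0 ->
    beta >= Rmax delta (- delta - 1) ->
    alpha = beta - delta ->
    exists xi : R,
      unique (fun z => 0 < z /\ xi_equation a k gamma T0 beta delta alpha z) xi /\
      kummerM (- (alpha / 2) + 1 / 2) (3 / 2) (- xi ^ 2) <> 0 /\
      stefan_solution a k T0 alpha (latent_heat gamma beta delta)
        (temperature a T0 alpha xi) (front a xi) /\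
      similarity_type a alpha (temperature a T0 alpha xi) (front a xi) /\
      (forall (T : R -> R -> R) (s : R -> R),
         stefan_solution a k T0 alpha (latent_heat gamma beta delta) T s ->
         similarity_type a alpha T s ->
         (forall t, 0 <= t -> s t = front a xi t) /\
         (forall x t, phase s x t -> T x t = temperature a T0 alpha xi x t)).
Proof.
  intros a k gamma T0 beta delta alpha Ha Hk Hg HT0 Hb Hab.
  assert (B1 := Rmax_l delta (- delta - 1)).
  assert (B2 := Rmax_r delta (- delta - 1)).
  assert (Hal : 0 <= alpha) by lra.
  destruct (xi_equation_unique_root a k gamma T0 beta delta alpha)
    as [xi Hxi]; auto; [lra|].
  assert (Hroot := Hxi). destruct Hroot as [[Hpos Heq] Huniq].
  exists xi. split; [exact Hxi|]. split; [|split; [|split]].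
  - intros E. destruct (f_xi_odd_sol alpha xi Hal Hpos) as [HB _].
    unfold odd_sol in HB. rewrite E in HB. lra.
  - now apply temperature_solves_stefan with (gamma := gamma).
  - exists (profile alpha T0 (coef2 T0 alpha xi)), xi.
    split; [exact Hpos|]. split; [reflexivity|].
    intros x t _. apply temperature_profile.
  - intros T s HS (phi & xi' & Hxi' & Hs & HT).
    assert (E : xi = xi').
    { apply Huniq. split; [exact Hxi'|].
      now apply (similarity_solution_xi_equation a k gamma T0 beta delta alpha
        T s phi). }
    subst xi'. split.
    + intros t [Ht | <-]; [now apply Hs|].
      rewrite (stefan_initial _ _ _ _ _ _ _ HS).
      unfold front. rewrite sqrt_0. ring.
    + now apply (similarity_temperature_unique a k T0 alpha
        (latent_heat gamma beta delta) T s phi).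
Qed.
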